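(* Let $2<2q<3$ and let $w\in W^{1,2q}(B;\mathbb{R}^3)$ be an admissible deformation. Let $f(k)=|k|^q$ for $k\in\mathbb{R}^3$, $G(w)=\operatorname{adj}\nabla w\left(\frac{w}{|w|^3}\right)$ and $I(w)=\int_B f(G(w))\,dx$. Then $$I(w)\ \ge\ I(\mathbf{i})+q\int_B\frac{x}{|x|^{2q-1}}\cdot G(w)\,dx-q\int_B\frac{1}{|x|^{2q}}\,dx .$$
   Context: $B$ is the unit ball in $\mathbb{R}^3$ and $\mathbf{i}$ is the identity map. For a $3\times3$ matrix $F$, $\operatorname{adj}F=(\operatorname{cof}F)^T$. A deformation is a map $w\in W^{1,2q}(B;\mathbb{R}^3)$ with $\det\nabla w>0$ a.e. which is one-to-one almost everywhere. An admissible deformation is a deformation with $w=\mathbf{i}$ on $\partial B$ for which there are a Lebesgue null set $N\subset B$ and an open set $U\subset B$ such that either (I) $0\in U$ and $w(B\setminus N)\cap U=\emptyset$; or (II) $0\in w(U)$, $w|_U$ is a diffeomorphism, and $w(B\setminus(U\cup N))\cap w(U)=\emptyset$. *)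

(* Defs.v *)
From HB Require Import structures.
From mathcomp Require Import all_boot all_order all_algebra.
From mathcomp Require Import all_classical all_reals all_analysis.
Set Implicit Arguments.
Unset Strict Implicit.
Unset Printing Implicit Defensive.
Import Order.TTheory GRing.Theory Num.Theory.
Import numFieldNormedType.Exports.
Local Open Scope classical_set_scope.
Local Open Scope ring_scope.

(* Column vectors carry the sigma-algebra generated by their coordinates, as
   the library does for n.-tuple; this is the Borel sigma-algebra of R^n. *)
Section measurable_cV.
Context {R : realType}.
Variable n : nat.

Definition cV_coord (i : 'I_n) (x : 'cV[R]_n) : R := x i 0.

Let cV_set0 : g_sigma_preimage cV_coord set0.
Proof. exact: sigma_algebra0. Qed.

Let cV_setC A : g_sigma_preimage cV_coord A -> g_sigma_preimage cV_coord (~` A).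
Proof. exact: sigma_algebraC. Qed.

Let cV_bigcup (F : _^nat) : (forall i, g_sigma_preimage cV_coord (F i)) ->
  g_sigma_preimage cV_coord (\bigcup_i (F i)).
Proof. exact: sigma_algebra_bigcup. Qed.

HB.instance Definition _ := @isMeasurable.Build
  (measure_tuple_display default_measure_display)
  'cV[R]_n (g_sigma_preimage cV_coord) cV_set0 cV_setC cV_bigcup.

End measurable_cV.

Lemma measurable_fun_cVP (R : realType) d (T : measurableType d) n
    (f : T -> 'cV[R]_n) :
  measurable_fun setT f <-> forall i, measurable_fun setT (fun x => f x i 0).
Proof.
apply: (@iff_trans _ (g_sigma_preimage (fun i => @cV_coord R n i \o f)
    `<=` measurable)).
  rewrite g_sigma_preimage_comp; split=> [mf A [/= C preC <-]|prefS].
    exact: mf.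
  by move=> _ A mA; apply: prefS; exists A.
split=> [fS i|mf].
- move=> _ A mA; apply: fS; apply: sub_sigma_algebra.
  case: n i => [[] []//|n' i] in f *.
  rewrite -bigcup_mkord_ord; exists i; first exact: ltn_ord.
  by exists A => //; rewrite inord_val.
- apply: smallest_sub; first exact: sigma_algebra_measurable.
  case: n => [|n'] in f mf *; first by rewrite big_ord0.
  rewrite -bigcup_mkord_ord; apply: bigcup_sub => i Ii.
  by move=> A [B mB <-]; exact: mf.
Qed.

Section space.
Context {R : realType}.
Local Notation E := 'cV[R]_3.

Definition vec3 (t : R * R * R) : E :=
  \col_i [:: t.1.1; t.1.2; t.2]`_i.

Lemma measurable_vec3 : measurable_fun [set: R * R * R] vec3.
Proof.
apply/measurable_fun_cVP => i.
rewrite (_ : (fun x => _) = (fun t : R * R * R => [:: t.1.1; t.1.2; t.2]`_i)).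
  case: i => -[|[|[|//]]] ? /=.
  - exact: (measurableT_comp measurable_fst measurable_fst).
  - exact: (measurableT_comp measurable_snd measurable_fst).
  - exact: measurable_snd.
by apply/funext => t; rewrite mxE.
Qed.

Definition leb3 : set E -> \bar R :=
  pushforward ((@lebesgue_measure R \x @lebesgue_measure R)
               \x @lebesgue_measure R)%E vec3.

Let preimage_vec3 A : measurable A -> measurable (vec3 @^-1` A).
Proof. by move=> mA; rewrite -[X in measurable X]setTI; exact: measurable_vec3. Qed.

Let leb30 : leb3 set0 = 0%E.
Proof. by rewrite /leb3 /pushforward preimage_set0 measure0. Qed.

Let leb3_ge0 A : (0 <= leb3 A)%E.
Proof. by rewrite /leb3 /pushforward; exact: measure_ge0. Qed.

Let leb3_sigma_additive : semi_sigma_additive leb3.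
Proof.
move=> F mF tF mUF; rewrite /leb3 /pushforward preimage_bigcup.
apply: measure_semi_sigma_additive.
- by move=> n; exact: preimage_vec3.
- apply/trivIsetP => /= i j _ _ ij; rewrite -preimage_setI.
  by move/trivIsetP : tF => /(_ _ _ _ _ ij) ->//; rewrite preimage_set0.
- by rewrite -preimage_bigcup; exact: preimage_vec3.
Qed.

HB.instance Definition _ := isMeasure.Build _ _ _
  leb3 leb30 leb3_ge0 leb3_sigma_additive.

Definition dotv (x y : E) : R := \sum_i x i 0 * y i 0.

(* The library norm on matrices is the sup norm; |.| in the statement is
   Euclidean. *)
Definition enorm (x : E) : R := Num.sqrt (dotv x x).

Definition unit_ball : set E := [set x | enorm x < 1].

Definition e_ (j : 'I_3) : E := delta_mx j 0.

Definition partial (j : 'I_3) (f : E -> R) : E -> R := fun x => 'D_(e_ j) f x.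

(* C^infty: every iterated partial derivative is differentiable *)
Definition smooth (f : E -> R) :=
  forall (s : seq 'I_3) (x : E), differentiable (foldr partial f s) x.

Definition test_function (Om : set E) (phi : E -> R) :=
  [/\ smooth phi,
      compact (closure [set x | phi x != 0]) &
      closure [set x | phi x != 0] `<=` Om].

Definition Lp_fun (p : R) (Om : set E) (f : E -> R) :=
  measurable_fun Om f /\
  (\int[leb3]_(x in Om) (`|f x| `^ p)%:E < +oo)%E.

(* Du j is the j-th distributional derivative of u in Om *)
Definition weak_gradient (Om : set E) (u : E -> R) (Du : 'I_3 -> E -> R) :=
  forall (phi : E -> R) (j : 'I_3), test_function Om phi ->
    \int[leb3]_(x in Om) (u x * partial j phi x) =
    - \int[leb3]_(x in Om) (Du j x * phi x).

(* u in W^{1,p}(Om), with gradient Du *)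
Definition sobolev (p : R) (Om : set E) (u : E -> R) (Du : 'I_3 -> E -> R) :=
  [/\ Lp_fun p Om u, forall j, Lp_fun p Om (Du j) & weak_gradient Om u Du].

(* u in W_0^{1,p}(Om), the closure of C_c^infty(Om) in W^{1,p}(Om) *)
Definition sobolev0 (p : R) (Om : set E) (u : E -> R) (Du : 'I_3 -> E -> R) :=
  sobolev p Om u Du /\
  exists phi : nat -> E -> R,
    [/\ forall n, test_function Om (phi n),
        (\int[leb3]_(x in Om) (`|u x - phi n x| `^ p)%:E)%E @[n --> \oo] --> 0%E &
        forall j, (\int[leb3]_(x in Om)
          (`|Du j x - partial j (phi n) x| `^ p)%:E)%E @[n --> \oo] --> 0%E].

(* w in W^{1,p}(Om; R^3), with gradient (Dw x) i j = d_j w_i (x) *)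
Definition sobolev_map (p : R) (Om : set E) (w : E -> E) (Dw : E -> 'M[R]_3) :=
  forall i, sobolev p Om (fun x => w x i 0) (fun j x => Dw x i j).

(* w = v on the boundary of Om in the sense of traces: w - v in W_0^{1,p} *)
Definition same_trace (p : R) (Om : set E)
    (w : E -> E) (Dw : E -> 'M[R]_3) (v : E -> E) (Dv : E -> 'M[R]_3) :=
  forall i, sobolev0 p Om (fun x => w x i 0 - v x i 0)
                          (fun j x => Dw x i j - Dv x i j).

Definition injective_ae (Om : set E) (w : E -> E) :=
  exists N, leb3.-negligible N /\ set_inj (Om `\` N) w.

Definition C1_on (U : set E) (f : E -> E) :=
  forall x, U x -> differentiable f x /\
    forall j, {for x, continuous (fun y => 'D_(e_ j) f y)}.

(* for U open, w|_U is a C^1 diffeomorphism onto the open set w(U) *)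
Definition diffeo_on (U : set E) (w : E -> E) :=
  [/\ C1_on U w, open (w @` U) &
      exists g : E -> E, C1_on (w @` U) g /\ forall x, U x -> g (w x) = x].

(* Dw is a representative of the weak gradient of w; it is determined by w up
   to a null set, so nothing below depends on its choice. *)
Definition deformation (q : R) (w : E -> E) (Dw : E -> 'M[R]_3) :=
  [/\ sobolev_map (2 * q) unit_ball w Dw,
      {ae leb3, forall x, unit_ball x -> 0 < \det (Dw x)} &
      injective_ae unit_ball w].

Definition admissible (q : R) (w : E -> E) (Dw : E -> 'M[R]_3) :=
  [/\ deformation q w Dw,
      same_trace (2 * q) unit_ball w Dw id (fun=> 1%:M) &
      exists N U : set E,
        [/\ N `<=` unit_ball, leb3.-negligible N, U `<=` unit_ball, open U &
            (U 0 /\ (w @` (unit_ball `\` N)) `&` U = set0) \/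
            [/\ (w @` U) 0, diffeo_on U w &
                (w @` (unit_ball `\` (U `|` N))) `&` (w @` U) = set0]]].

Definition G (w : E -> E) (Dw : E -> 'M[R]_3) (x : E) : E :=
  \adj (Dw x) *m ((enorm (w x) ^+ 3)^-1 *: w x).

Definition fq (q : R) (k : E) : R := enorm k `^ q.

Definition energy (q : R) (w : E -> E) (Dw : E -> 'M[R]_3) : \bar R :=
  (\int[leb3]_(x in unit_ball) (fq q (G w Dw x))%:E)%E.

End space.

(* Main.v *)
Require Import Defs.
From mathcomp Require Import all_boot all_order all_algebra.
From mathcomp Require Import all_classical all_reals all_analysis.
From mathcomp Require Import measurable_realfun ring lra.
Import Order.TTheory GRing.Theory Num.Theory.
Import numFieldNormedType.Exports.
Local Open Scope classical_set_scope.
Local Open Scope ring_scope.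

(** Since f is convex and even, f(k) + (q - 1) |x|^(-2q) >= q |a.k| for all k,
where a = x / |x|^(2q-1), so that q a is the gradient of f at
x / |x|^3 = G(i)(x) and f(G(i)(x)) = a.G(i)(x) = |x|^(-2q).  With k = G(w)(x)
this bound shows that a.G(w) is integrable as soon as I(w) is finite, and
integrating it gives the proposition. *)

Section euclidean.
Context {R : realType}.
Local Notation E := 'cV[R]_3.
Implicit Types (x y : E) (a : R).

Lemma dotvv_ge0 x : 0 <= dotv x x.
Proof. by apply: sumr_ge0 => i _; rewrite -expr2 sqr_ge0. Qed.

Lemma enorm_ge0 x : 0 <= enorm x.
Proof. exact: sqrtr_ge0. Qed.

Lemma dotvZl a x y : dotv (a *: x) y = a * dotv x y.
Proof. by rewrite mulr_sumr; apply: eq_bigr => i _; rewrite mxE mulrA. Qed.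

Lemma enormZ a x : enorm (a *: x) = `|a| * enorm x.
Proof.
rewrite /enorm (_ : dotv _ _ = a ^+ 2 * dotv x x).
  by rewrite sqrtrM ?sqr_ge0// sqrtr_sqr.
by rewrite mulr_sumr; apply: eq_bigr => i _; rewrite mxE; ring.
Qed.

(** Lagrange's identity: after squaring, the difference of the two sides is the squared length of
    the cross product of [x] and [y]. *)
Lemma dotv_CauchySchwarz x y : `|dotv x y| <= enorm x * enorm y.
Proof.
rewrite /enorm -sqrtrM ?dotvv_ge0// -sqrtr_sqr.
rewrite ler_sqrt ?mulr_ge0 ?dotvv_ge0//.
rewrite /dotv !big_ord_recl !big_ord0 -subr_ge0 !addr0.
set x1 := x _ 0; set x2 := x _ 0; set x3 := x _ 0.
set y1 := y _ 0; set y2 := y _ 0; set y3 := y _ 0.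
rewrite [leRHS](_ : _ = (x1 * y2 - x2 * y1) ^+ 2 + (x1 * y3 - x3 * y1) ^+ 2
  + (x2 * y3 - x3 * y2) ^+ 2); last by ring.
by rewrite !addr_ge0 ?sqr_ge0.
Qed.

End euclidean.

Section measurability.
Context {R : realType}.
Local Notation E := 'cV[R]_3.

Lemma measurable_coord n (i : 'I_n) :
  measurable_fun setT (fun x : 'cV[R]_n => x i 0).
Proof. by move/measurable_fun_cVP: (@measurable_id _ 'cV[R]_n setT). Qed.

Context d (T : measurableType d) (D : set T).

Lemma measurable_dotv (u v : T -> E) :
  (forall i, measurable_fun D (fun x => u x i 0)) ->
  (forall i, measurable_fun D (fun x => v x i 0)) ->
  measurable_fun D (fun x => dotv (u x) (v x)).
Proof.
by move=> mu mv; apply: measurable_sum => i; exact: measurable_funM.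
Qed.

Lemma measurable_enorm (u : T -> E) :
  (forall i, measurable_fun D (fun x => u x i 0)) ->
  measurable_fun D (fun x => enorm (u x)).
Proof.
move=> mu; rewrite (_ : (fun x => _) = (fun x => dotv (u x) (u x) `^ 2^-1)).
  exact/(measurableT_comp (measurable_powR _))/measurable_dotv.
by apply/funext => x; rewrite powR12_sqrt ?dotvv_ge0.
Qed.

(** On nonnegative reals the inverse is the power of exponent -1, and powers are measurable. This
    covers zeros of [u] too: there both expressions are 0 by convention. *)
Lemma measurable_inv_ge0 (u : T -> R) : (forall x, 0 <= u x) ->
  measurable_fun D u -> measurable_fun D (fun x => (u x)^-1).
Proof.
move=> u0 mu; rewrite (_ : (fun x => _) = (fun x => u x `^ (-1))).
  exact: measurableT_comp (measurable_powR _) mu.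
by apply/funext => x; rewrite powR_inv1.
Qed.

Lemma measurable_det n (M : T -> 'M[R]_n) :
  (forall i j, measurable_fun D (fun x => M x i j)) ->
  measurable_fun D (fun x => \det (M x)).
Proof.
move=> mM; apply: measurable_sum => s.
by apply: measurable_funM => //; apply: measurable_prod.
Qed.

(** Each entry is a signed minor, hence the determinant of a matrix whose entries are entries of
    [M]. *)
Lemma measurable_adj n (M : T -> 'M[R]_n) :
  (forall i j, measurable_fun D (fun x => M x i j)) ->
  forall i j, measurable_fun D (fun x => (\adj (M x)) i j).
Proof.
move=> mM i j; rewrite (_ : (fun x => _) = (fun x =>
    (-1) ^+ (j + i) * \det (row' j (col' i (M x))))).
  apply: measurable_funM => //; apply: measurable_det => k l.
  rewrite (_ : (fun x => _) = (fun x => M x (lift j k) (lift i l)))//.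
  by apply/funext => x; rewrite !mxE.
by apply/funext => x; rewrite mxE.
Qed.

End measurability.

Section energy.
Context {R : realType}.
Local Notation E := 'cV[R]_3.
Implicit Types (x k : E) (q : R).

(** The sigma-algebra is generated by the coordinates, so the ball is obtained as a preimage under
    [enorm] rather than from its openness. *)
Lemma measurable_unit_ball : measurable (@unit_ball R).
Proof.
rewrite (_ : unit_ball = setT `&` enorm @^-1` `]-oo, 1[).
  apply: measurable_enorm => //; exact: measurable_coord.
by apply/seteqP; split=> x /=; rewrite in_itv//= => -[].
Qed.

Lemma measurable_G (Om : set E) (w : E -> E) (Dw : E -> 'M[R]_3) :
  (forall i, measurable_fun Om (fun x => w x i 0)) ->
  (forall i j, measurable_fun Om (fun x => Dw x i j)) ->
  forall i, measurable_fun Om (fun x => G w Dw x i 0).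
Proof.
move=> mw mDw i.
rewrite (_ : (fun x => _) = (fun x => \sum_j
    (\adj (Dw x)) i j * ((enorm (w x) ^+ 3)^-1 * w x j 0))); last first.
  apply/funext => x; rewrite mxE; apply: eq_bigr => j _.
  by rewrite [X in _ * X]mxE.
apply: measurable_sum => j; apply: measurable_funM; first exact: measurable_adj.
apply: measurable_funM => //; apply: measurable_inv_ge0.
  by move=> x; rewrite exprn_ge0 ?enorm_ge0.
exact/measurable_funX/measurable_enorm.
Qed.

(** Here G(i)(x) = x / |x|^3 has length |x|^(-2). At the origin both sides are 0, because the
    inverse of 0 is 0 and 0 to a nonzero power is 0. *)
Lemma fq_G_id q x : 0 < q ->
  fq q (G id (fun=> 1%:M) x) = (enorm x `^ (2 * q))^-1.
Proof.
move=> q0; rewrite /fq /G adj1 mul1mx enormZ.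
rewrite ger0_norm ?invr_ge0 ?exprn_ge0 ?enorm_ge0//.
have [->|x0] := eqVneq (enorm x) 0.
  by rewrite mulr0 !powR0 ?invr0 ?mulf_neq0 ?gt_eqF.
rewrite (_ : (enorm x ^+ 3)^-1 * enorm x = enorm x `^ (- 2)).
  by rewrite -powRrM mulNr powRN.
by rewrite powRN powR_mulrn ?enorm_ge0//; field.
Qed.

(** Cauchy-Schwarz, then Young's inequality for |k| and |a| with the conjugate exponents q and q /
    (q - 1). The absolute value on the left is what later yields integrability, and not only an
    upper bound. *)
Lemma fq_young q x k : 1 < q ->
  q * `|dotv ((enorm x `^ (2 * q - 1))^-1 *: x) k|
  <= fq q k + (q - 1) * (enorm x `^ (2 * q))^-1.
Proof.
move=> q1; have q0 : 0 < q by lra.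
(* At the origin the conventions for 0 make the left side and the last term vanish, leaving 0 <=
   f(k). *)
have [x0|x0] := eqVneq (enorm x) 0.
  rewrite dotvZl x0 !powR0 ?invr0 ?mul0r ?normr0 ?mulr0 ?addr0 ?powR_ge0//;
    by rewrite gt_eqF//; lra.
set a := _ *: x.
have aE : enorm a = enorm x `^ (2 - 2 * q).
  rewrite enormZ ger0_norm ?invr_ge0 ?powR_ge0// -powRN.
  rewrite -[X in _ * X]powRr1 ?enorm_ge0// -powRD ?x0 ?implybT//.
  by congr (_ `^ _); ring.
have qn0 : q != 0 by rewrite gt_eqF.
have q1n0 : q - 1 != 0 by rewrite subr_eq0 gt_eqF.
have p0 : 0 < q / (q - 1) by rewrite divr_gt0// subr_gt0.
have pq : q^-1 + (q / (q - 1))^-1 = 1 by field; rewrite qn0 q1n0.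
have := conjugate_powR (enorm_ge0 k) (enorm_ge0 a) q0 p0 pq.
(* The conjugate power of |a| = |x|^(2 - 2q) is exactly |x|^(-2q). *)
rewrite aE -powRrM (_ : (2 - 2 * q) * (q / (q - 1)) = - (2 * q)); last first.
  by field.
rewrite powRN -aE => young.
apply: (@le_trans _ _ (q * (enorm k * enorm a))).
  by rewrite ler_pM2l// mulrC dotv_CauchySchwarz.
apply: (le_trans (ler_wpM2l (ltW q0) young)).
rewrite /fq le_eqVlt; apply/orP; left; apply/eqP.
by field; rewrite qn0 q1n0 gt_eqF// powR_gt0// lt0r x0 enorm_ge0.
Qed.

End energy.

Theorem proposition3p1 (R : realType) (q : R)
    (w : 'cV[R]_3 -> 'cV[R]_3) (Dw : 'cV[R]_3 -> 'M[R]_3)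
    (hq2 : 2 < 2 * q) (hq3 : 2 * q < 3) (hw : admissible q w Dw) :
  (energy q id (fun=> 1%:M)
   + q%:E * \int[leb3]_(x in unit_ball)
       (dotv ((enorm x `^ (2 * q - 1))^-1 *: x) (G w Dw x))%:E
   - q%:E * \int[leb3]_(x in unit_ball) ((enorm x `^ (2 * q))^-1)%:E
   <= energy q w Dw)%E.
Proof.
have q1 : 1 < q by lra.
have q0 : 0 < q by lra.
case: hw => -[sw _ _] _ _.
have mB := @measurable_unit_ball R.
(* Membership in the Sobolev space includes measurability of the components of [w] and [Dw] on the
   ball. *)
have mG : forall i, measurable_fun unit_ball (fun x => G w Dw x i 0).
  apply: measurable_G => [i|i j]; first by have [[]] := sw i.
  by have [_ /(_ j)[]] := sw i.
have mcoord i : measurable_fun unit_ball (fun x : 'cV[R]_3 => x i 0).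
  by apply: measurable_funTS; exact: (@measurable_coord R 3).
have menorm := measurable_enorm _ _ _ _ mcoord.
pose K (x : 'cV[R]_3) := (enorm x `^ (2 * q))^-1.
pose F x := fq q (G w Dw x).
pose H x := dotv ((enorm x `^ (2 * q - 1))^-1 *: x) (G w Dw x).
have K0 x : 0 <= K x by rewrite invr_ge0 powR_ge0.
have F0 x : 0 <= F x by exact: powR_ge0.
have mK : measurable_fun unit_ball K.
  apply: measurable_inv_ge0 => [x|]; first exact: powR_ge0.
  exact: measurableT_comp (measurable_powR _) menorm.
have mF : measurable_fun unit_ball F.
  exact/(measurableT_comp (measurable_powR _))/measurable_enorm.
have mH : measurable_fun unit_ball H.
  apply: measurable_dotv => // i.
  rewrite (_ : (fun x => _) = (fun x => (enorm x `^ (2 * q - 1))^-1 * x i 0)).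
    apply: measurable_funM => //.
    apply: measurable_inv_ge0 => [x|]; first exact: powR_ge0.
    exact: measurableT_comp (measurable_powR _) menorm.
  by apply/funext => x; rewrite mxE.
have -> : energy q id (fun=> 1%:M) = (\int[leb3]_(x in unit_ball) (K x)%:E)%E.
  by apply: eq_integral => x _; rewrite fq_G_id.
rewrite -/K -/F /energy.
have integrable_ge0 (f : 'cV[R]_3 -> R) : (forall x, 0 <= f x) ->
    measurable_fun unit_ball f ->
    (\int[leb3]_(x in unit_ball) (f x)%:E)%E != +oo%E ->
    leb3.-integrable unit_ball (EFin \o f).
  move=> f0 mf foo; apply/integrableP; split; first exact/measurable_EFinP.
  rewrite ltey; under eq_integral do rewrite /= ger0_norm//.
  exact: foo.
(* The case of an infinite integral of K does not occur for 2q < 3; here the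
   left-hand side is -oo, because +oo - +oo = -oo. *)
have [->|/(integrable_ge0 _ K0 mK) iK] :=
  eqVneq (\int[leb3]_(x in unit_ball) (K x)%:E)%E +oo%E.
  by rewrite gt0_muley ?lte_fin// addeNy leNye.
have [->|/(integrable_ge0 _ F0 mF) iF] :=
  eqVneq (\int[leb3]_(x in unit_ball) (F x)%:E)%E +oo%E; first by rewrite leey.
have young x : q * `|H x| <= F x + (q - 1) * K x by exact: fq_young.
(* By [young], |H| is dominated by (F + (q - 1) K) / q, whose two terms now have finite
   integrals. *)
have iH : leb3.-integrable unit_ball (EFin \o H).
  apply: (@le_integrable _ _ _ leb3 _ mB _
      (fun x => (q^-1)%:E * ((F x)%:E + (q - 1)%:E * (K x)%:E))%E).
  - exact/measurable_EFinP.
  - move=> x _; rewrite /= lee_fin ler_normr -ler_pdivrMl ?invr_gt0//.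
    by rewrite invrK young.
  - by apply/integrableZl => //; apply/integrableD => //; exact: integrableZl.
have iqH := integrableZl mB q iH.
have iqK := integrableZl mB q iK.
(* With [K], [H] and [F] all integrable, linearity reduces the claim to the pointwise bound K + q H
   - q K <= F, which is [young] together with H <= |H|. *)
rewrite -(integralZl mB iH) -(integralZl mB iK).
rewrite -integralD// -integralB//; last exact: integrableD.
apply: le_integral => //; first by apply: integrableB => //; exact: integrableD.
move=> x _; rewrite /= lee_fin -/(K x) -/(H x) -/(F x).
have := young x; rewrite mulrBl mul1r.
have := ler_wpM2l (ltW q0) (ler_norm (H x)); lra.
Qed.
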